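(* Let $b$ be an integer with $2\le b\le 10$. All solutions of $$P_n=b^{d}Q_m+P_k$$ in nonnegative integers $n,m,k$, where $d$ is the number of digits of $P_k$ in base $b$, are given by the following representations (in particular $P_n\in\{5,12,29,70\}$): $$5=P_3=2^1Q_0+P_1=2^1Q_1+P_1,$$ $$12=P_4=5^1Q_0+P_2=5^1Q_1+P_2=2^1Q_2+P_0,$$ $$12=P_4=6^1Q_0+P_0=6^1Q_1+P_0,$$ $$29=P_5=2^1Q_3+P_1,$$ $$70=P_6=5^1Q_3+P_0.$$
   Context: $(P_n)_{n\ge0}$ is the Pell sequence: $P_0=0$, $P_1=1$, $P_n=2P_{n-1}+P_{n-2}$ for $n\ge2$. $(Q_n)_{n\ge0}$ is the Pell–Lucas sequence: $Q_0=2$, $Q_1=2$, $Q_n=2Q_{n-1}+Q_{n-2}$ for $n\ge2$. For a positive integer $N$, the number of digits of $N$ in base $b$ is $\lfloor \log_b N\rfloor+1$; the number $0$ (i.e. $P_0$) is taken to have $d=1$ digit. *)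

(* Defs.v *)
From mathcomp Require Import all_boot.
Set Implicit Arguments. Unset Strict Implicit. Unset Printing Implicit Defensive.

Fixpoint Pell (n : nat) : nat :=
  match n with
  | 0 => 0
  | 1 => 1
  | (n'.+1 as m).+1 => 2 * Pell m + Pell n'
  end.

Fixpoint PellLucas (n : nat) : nat :=
  match n with
  | 0 => 2
  | 1 => 2
  | (n'.+1 as m).+1 => 2 * PellLucas m + PellLucas n'
  end.

Definition ndigits (b N : nat) : nat :=
  if N == 0 then 1 else (trunc_log b N).+1.

(* Main.v *)
Require Import Defs.
From Stdlib Require Import NArith.
From mathcomp Require Import all_boot zify ring.

(** Every Pell-Lucas number is even, so [n] and [k] have the same parity; with
    [n = t + s] and [k = t - s] the difference [P_n - P_k = b^d Q_m] is then
    [P_s Q_t] or [P_t Q_s].  For p = 2, 3, 5, 7 the valuation of [P_x] exceeds that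
    of [x] by at most 1, so every power of [b] dividing such a product is polynomial
    in [s t].  As [P_k < b^d] grows exponentially in [k] while [n <= m + k + 4], this
    bounds [k] when [m < k].  When [m >= k], the congruence
    [P_(m+j) = +- P_(|m-j|)] modulo [Q_m], with [j = n - m], leaves residues too small
    to differ, hence [b^d = P_j], and the same valuation bound limits [j].  The
    remaining cases are checked by computation. *)

(** * Identities and growth of Pell and Pell-Lucas numbers *)

Lemma PellSS n : Pell n.+2 = 2 * Pell n.+1 + Pell n. Proof. by []. Qed.

Lemma PellLucasSS n : PellLucas n.+2 = 2 * PellLucas n.+1 + PellLucas n.
Proof. by []. Qed.

Lemma nat_ind2 (P : nat -> Prop) :
  P 0 -> P 1 -> (forall n, P n -> P n.+1 -> P n.+2) -> forall n, P n.
Proof.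
move=> P0 P1 PS n; suff [] : P n /\ P n.+1 by [].
by elim: n => [|n [Pn PSn]]; split=> //; apply: PS.
Qed.

Lemma PellD m n : Pell (m + n).+1 = Pell m.+1 * Pell n.+1 + Pell m * Pell n.
Proof.
elim/nat_ind2: m => [||m IH0 IH1]; rewrite ?mul0n ?mul1n ?addn0 //.
by rewrite !addSn !PellSS in IH0 IH1 *; nia.
Qed.

Lemma PellLucasE n : PellLucas n + 2 * Pell n = 2 * Pell n.+1.
Proof. by elim/nat_ind2: n => // n; rewrite PellLucasSS !PellSS; lia. Qed.

Lemma Pell_cassini n :
  Pell n.+1 ^ 2 + odd n = 2 * Pell n * Pell n.+1 + Pell n ^ 2 + ~~ odd n.
Proof. by elim: n => // n; rewrite PellSS oddS; case: (odd n) => /=; nia. Qed.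

(** Both sides obey the Pell recurrence in [i]; the cases [i = 0, 1] come from the addition formula
    and Cassini. The conditionals encode [P_(2c+i) = P_c Q_(c+i) + (-1)^c P_i] without
    subtraction. *)
Lemma PellDl c i :
  Pell (c + (c + i)) + (if odd c then Pell i else 0) =
  Pell c * PellLucas (c + i) + (if odd c then 0 else Pell i).
Proof.
elim/nat_ind2: i => [||i].
- rewrite addn0 !if_same; have := PellLucasE c; case: c => // c.
  have := PellD c c.+1; rewrite addSn PellSS => -> E; nia.
- have := PellLucasE c; have := PellLucasE c.+1; have := Pell_cassini c.
  rewrite addn1 addnS PellD PellSS; case: (odd c); rewrite /=; nia.
- by rewrite !addnS !PellSS PellLucasSS; case: (odd c); nia.
Qed.

Lemma PellDr c i :
  Pell (c + (c + i)) + (if odd c then 0 else Pell i) =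
  Pell (c + i) * PellLucas c + (if odd c then Pell i else 0).
Proof.
elim/nat_ind2: i => [||i].
- have := PellDl c 0; rewrite addn0 !if_same; lia.
- have := PellLucasE c; have := Pell_cassini c.
  rewrite addn1 addnS PellD; case: (odd c); rewrite /=; nia.
- by rewrite !addnS !PellSS; case: (odd c); nia.
Qed.

Lemma Pell_mul_PellLucas n : Pell n * PellLucas n = Pell (n + n).
Proof. by have := PellDl n 0; rewrite addn0 !if_same !addn0. Qed.

Lemma odd_Pell n : odd (Pell n) = odd n.
Proof. by elim/nat_ind2: n => // n IH _; rewrite PellSS oddD oddM IH /= negbK. Qed.

Lemma odd_PellLucas n : odd (PellLucas n) = false.
Proof. by elim/nat_ind2: n => // n IH _; rewrite PellLucasSS oddD oddM IH. Qed.

Lemma Pell_gt0 n : 0 < n -> 0 < Pell n.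
Proof. by case: n => // n _; elim: n => // n; rewrite PellSS; lia. Qed.

Lemma leq_Pell m n : m <= n -> Pell m <= Pell n.
Proof.
apply: (homo_leq (fun x => leqnn x) leq_trans) => k.
by case: k => // k; rewrite PellSS; lia.
Qed.

Lemma ltn_Pell_imp m n : Pell m < Pell n -> m < n.
Proof. by rewrite !ltnNge; apply/contra/leq_Pell. Qed.

Lemma ltn_Pell_PellLucas n : 1 < n -> 2 * Pell n < PellLucas n.
Proof.
case: n => [|[|n]] // _; have := PellLucasE n.+2; rewrite (PellSS n.+1) (PellSS n).
by have := Pell_gt0 n.+1 isT; lia.
Qed.

Lemma leq_PellLucas_Pell n : PellLucas n <= 2 * Pell n.+1.
Proof. by rewrite -PellLucasE leq_addr. Qed.

Lemma leq_Pell_PellLucas n : Pell n <= PellLucas n.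
Proof. by case: n => [|[|n]] //; have := ltn_Pell_PellLucas n.+2 isT; lia. Qed.

Lemma PellLucas_gt0 n : 0 < PellLucas n.
Proof. by elim/nat_ind2: n => // n; rewrite PellLucasSS; lia. Qed.

(** * Divisibility and valuations of Pell numbers *)

Lemma coprime_Pell n : coprime (Pell n) (Pell n.+1).
Proof.
elim: n => // n IH.
by rewrite PellSS coprime_sym /coprime gcdnC gcdnMDl -/(coprime _ _) coprime_sym.
Qed.

(* With [r = u.+1] and [M] the companion matrix, [M ^ r = P_r M + P_(r-1)]; this is
   the binomial expansion of [M ^ (r k.+2)] up to second order in [P_r]. *)
Lemma PellM_expand u k :
  exists a c,
  Pell (k.+2 * u.+1) =
    Pell u.+1 * (k.+2 * Pell u ^ k.+1 + k.+2 * k.+1 * Pell u.+1 * Pell u ^ k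
                 + Pell u.+1 ^ 2 * a) /\
  Pell (k.+2 * u.+1).+1 =
    Pell u ^ k.+2 + 2 * k.+2 * Pell u.+1 * Pell u ^ k.+1 + Pell u.+1 ^ 2 * c.
Proof.
have E0 i : Pell (i.+1 * u.+1) = Pell (i * u.+1).+1 * Pell u.+1
    + Pell (i * u.+1) * Pell u by rewrite -PellD mulSn addnC addnS.
have E1 i : Pell (i.+1 * u.+1).+1 =
    Pell (i * u.+1).+1 * (2 * Pell u.+1 + Pell u) + Pell (i * u.+1) * Pell u.+1.
  by rewrite -PellSS -PellD mulSn addnC.
elim: k => [|k [a [c [IH0 IH1]]]].
  exists 0, 5; rewrite (E0 1) (E1 1) !mul1n PellSS !(expnS, expn0).
  split; ring.
exists (c + Pell u * a), (c * (2 * Pell u.+1 + Pell u) + 4 * k.+2 * Pell u ^ k.+1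
  + (k.+2 * Pell u ^ k.+1 + k.+2 * k.+1 * Pell u.+1 * Pell u ^ k
      + Pell u.+1 ^ 2 * a)).
rewrite (E0 k.+2) (E1 k.+2) IH0 IH1 -[k.+3]add1n -[k.+2]add1n -[k.+1]add1n !expnD !expn1.
split; ring.
Qed.

Lemma dvdn_Pell_mul r q : Pell r %| Pell (q * r).
Proof.
case: r => [|r]; first by rewrite muln0.
case: q => [|[|q]]; rewrite ?dvdn0 ?mul1n //.
by have [a [c [-> _]]] := PellM_expand r q; apply: dvdn_mulr.
Qed.

(** Modulo [d], the addition formula at [n = q r + i] leaves [P_(qr+1) P_i], whose first factor is a
    unit; so a nonzero remainder [i] would contradict the minimality of [r]. *)
Lemma dvdn_Pell_rank d r n :
  0 < r -> d %| Pell r -> (forall i, 0 < i < r -> ~~ (d %| Pell i)) ->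
  d %| Pell n -> r %| n.
Proof.
case: r => // r _ dr rank dn; apply: contraLR (dn) => nr.
have {nr} lt0 : 0 < n %% r.+1 by rewrite lt0n -/(_ %| _).
rewrite (divn_eq n r.+1); case E : (n %% r.+1) lt0 => [//|i] _.
have ri : i < r by have := ltn_mod n r.+1; rewrite E; lia.
rewrite addnS PellD dvdn_addl; last by rewrite dvdn_mulr ?(dvdn_trans dr) ?dvdn_Pell_mul.
rewrite Gauss_dvdr ?rank ?ltnS //.
apply: coprime_dvdl (coprime_Pell _).
by apply: dvdn_trans dr _; apply: dvdn_Pell_mul.
Qed.

Lemma logn_PellMp p u :
  prime p -> p %| Pell u.+1 -> logn p (Pell (p * u.+1)) = (logn p (Pell u.+1)).+1.
Proof.
move=> pp pu; have pw : coprime p (Pell u).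
  by apply: coprime_dvdl pu _; rewrite coprime_sym coprime_Pell.
case: p => [|[|p]] // in pp pu pw *.
have [a [_ [-> _]]] := PellM_expand u p; case/dvdnP: (pu) => z zE.
set X := (X in _ * X); pose Y := Pell u ^ p.+1 + p.+2 * (z * p.+1 * Pell u ^ p + z ^ 2 * a).
(* Since [p] divides [P_(u+1)], the terms of [X] after the first contain [p ^ 2], so [Y] is a power
   of [P_u] modulo [p], hence a unit. *)
have XE : X = p.+2 * Y by rewrite /X /Y zE; ring.
have Y_gt0 : 0 < Y by rewrite addn_gt0 expn_gt0; case: (Pell u) pw => //; rewrite coprimen0.
have pY : logn p.+2 Y = 0.
  apply: logn_coprime; rewrite prime_coprime // dvdn_addl ?dvdn_mulr //.
  by rewrite -prime_coprime // coprimeXr.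
by rewrite XE lognM ?Pell_gt0 ?muln_gt0 ?Y_gt0 // lognM // pY (logn_prime _ pp) eqxx addn1.
Qed.

(** Strong induction on [n]: valuation at least 2 forces [n = q r], and as [P_r] has valuation 1,
    the expansion gives [p %| q]. Passing from [n] to [n / p] then lowers both valuations by one. *)
Lemma logn_Pell_le p r n :
  prime p -> 0 < r -> logn p (Pell r) = 1 ->
  (forall i, 0 < i < r -> ~~ (p %| Pell i)) ->
  0 < n -> logn p (Pell n) <= (logn p n).+1.
Proof.
move=> pp r_gt0 lr rank; elim/ltn_ind: n => n IH n_gt0.
have pr : p %| Pell r by rewrite -[p]expn1 pfactor_dvdn ?Pell_gt0 // lr.
have [|l2] := leqP (logn p (Pell n)) 1; first by move=> /leq_trans; apply.
have pn : p %| Pell n by rewrite -[p]expn1 pfactor_dvdn ?Pell_gt0 // ltnW.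
have /dvdnP[q nE] := dvdn_Pell_rank _ _ _ r_gt0 pr rank pn.
have pq : p %| q.
  case: q => [|[|k]] in nE *; rewrite ?dvdn0 //; first by rewrite nE mul1n lr in l2.
  case: r => // r in r_gt0 lr rank pr nE *.
  have [a [_ [E _]]] := PellM_expand r k; rewrite nE E in l2.
  have {}E : k.+2 * Pell r ^ k.+1 + k.+2 * k.+1 * Pell r.+1 * Pell r ^ k
     + Pell r.+1 ^ 2 * a = k.+2 * Pell r ^ k.+1
     + Pell r.+1 * (k.+2 * k.+1 * Pell r ^ k + Pell r.+1 * a) by ring.
  have pw : coprime p (Pell r ^ k.+1).
    by rewrite coprimeXr // (coprime_dvdl pr) // coprime_sym coprime_Pell.
  suff : p %| k.+2 * Pell r ^ k.+1 + Pell r.+1 * (k.+2 * k.+1 * Pell r ^ k + Pell r.+1 * a).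
    by rewrite dvdn_addl ?(dvdn_mulr _ pr) // Gauss_dvdl.
  rewrite -E; move: l2; set X := (X in logn p (_ * X)); rewrite -/X.
  case: (posnP X) => [->|X_gt0]; first by rewrite dvdn0.
  rewrite lognM ?Pell_gt0 // lr.
  by rewrite ltnS logn_gt0 mem_primes pp => /and3P[].
case/dvdnP: pq nE => q' -> nE; rewrite mulnAC mulnC in nE.
rewrite nE; case: (q' * r) (dvdn_Pell_mul r q') nE n_gt0 => [|u] ru nE n_gt0.
  by rewrite nE muln0 in n_gt0.
rewrite logn_PellMp ?(dvdn_trans pr) // lognM ?(prime_gt0 pp) // (logn_prime _ pp) eqxx.
by rewrite add1n ltnS; apply: IH => //; rewrite nE ltn_Pmull ?prime_gt1.
Qed.

Lemma logn_Pell_small p n :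
  p \in [:: 2; 3; 5; 7] -> 0 < n -> logn p (Pell n) <= (logn p n).+1.
Proof.
have rank r q : all [pred i | ~~ (q %| Pell i)] (iota 1 r.-1) ->
    forall i, 0 < i < r -> ~~ (q %| Pell i).
  by move=> /allP H i ir; apply: H; rewrite mem_iota; lia.
rewrite !inE => /or4P[] /eqP ->.
(* Ranks of apparition, from [P_2 = 2], [P_4 = 12], [P_3 = 5] and [P_6 = 70]. *)
- by apply: (@logn_Pell_le 2 2) => //; apply: rank.
- by apply: (@logn_Pell_le 3 4) => //; apply: rank.
- by apply: (@logn_Pell_le 5 3) => //; apply: rank.
- by apply: (@logn_Pell_le 7 6) => //; apply: rank.
Qed.

Lemma leq_exp_dvdn_Pell p e x y :
  p \in [:: 2; 3; 5; 7] -> 0 < x -> 0 < y ->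
  p ^ e %| Pell x * Pell y -> p ^ e <= p ^ 2 * (x * y).
Proof.
move=> ps x_gt0 y_gt0.
have pp : prime p by move: ps; rewrite !inE => /or4P[] /eqP ->.
have p_gt0 := prime_gt0 pp.
rewrite pfactor_dvdn ?muln_gt0 ?Pell_gt0 // lognM ?Pell_gt0 // => le_e.
have p2_gt0 : 0 < p ^ 2 by rewrite expn_gt0 p_gt0.
have xy_gt0 : 0 < x * y by rewrite muln_gt0 x_gt0.
have pxy_gt0 : 0 < p ^ 2 * (x * y) by rewrite muln_gt0 p2_gt0.
apply: dvdn_leq => //; rewrite pfactor_dvdn // (lognM _ p2_gt0) // pfactorK // lognM //.
have := logn_Pell_small p x ps x_gt0; have := logn_Pell_small p y ps y_gt0; lia.
Qed.

(* [625 = (5 ^ 2) ^ 2] comes from [b = 10], through [10 ^ d <= (5 ^ d) ^ 2]. *)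
Lemma leq_expb_dvdn_Pell b d x y :
  2 <= b <= 10 -> 0 < x -> 0 < y ->
  b ^ d %| Pell x * Pell y -> b ^ d <= 625 * (x * y) ^ 2.
Proof.
move=> b_bd x_gt0 y_gt0 bd.
(* [p ^ f] is a prime power dividing [b], and [g] is the exponent needed to dominate [b]; only 6 and
   10 need [g = 2]. *)
have key p f g : p \in [:: 2; 3; 5; 7] -> p ^ f %| b -> b <= (p ^ f) ^ g ->
    (p ^ 2) ^ g <= 625 -> 0 < g <= 2 -> b ^ d <= 625 * (x * y) ^ 2.
  move=> ps pb bp p625 g_le.
  have le1 : (p ^ f) ^ d <= p ^ 2 * (x * y).
    rewrite -expnM; apply: leq_exp_dvdn_Pell => //.
    by rewrite expnM (dvdn_trans _ bd) // dvdn_exp2r.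
  apply: (@leq_trans (((p ^ f) ^ d) ^ g)).
    by rewrite expnAC; case: (d) => [|d'] //; rewrite leq_exp2r.
  apply: (@leq_trans ((p ^ 2 * (x * y)) ^ g)); first by rewrite leq_exp2r; lia.
  rewrite expnMn leq_mul // leq_pexp2l ?muln_gt0 ?x_gt0 //; lia.
move: b_bd key; clear.
do 11?[case: b => [|b] //]; move=> _ key.
- exact: (key 2 1 1).
- exact: (key 3 1 1).
- exact: (key 2 2 1).
- exact: (key 5 1 1).
- exact: (key 3 1 2).
- exact: (key 7 1 1).
- exact: (key 2 3 1).
- exact: (key 3 2 1).
- exact: (key 5 1 2).
Qed.

(** * Size of the digit power and of the index [n] *)

Lemma leq_PellM m n : Pell m.+1 * Pell n.+1 <= Pell (m + n).+1.
Proof. by rewrite PellD leq_addr. Qed.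

Lemma Pell_lt_exp4 n : Pell n < 4 ^ n.
Proof. by elim/nat_ind2: n => // n; rewrite PellSS !expnS; lia. Qed.

Lemma ndigits_gt0 b x : 0 < ndigits b x.
Proof. by rewrite /ndigits; case: (x == 0). Qed.

Lemma ltn_exp_ndigits b x : 1 < b -> x < b ^ ndigits b x.
Proof.
move=> b1; rewrite /ndigits; case: posnP => [->|x0]; first by rewrite expn_gt0 (ltnW b1).
exact: trunc_log_ltn.
Qed.

(** The maximum with 1 covers [x = 0], which counts as one digit. *)
Lemma leq_exp_ndigits b x : 1 < b -> b ^ (ndigits b x).-1 <= maxn 1 x.
Proof.
move=> b1; rewrite /ndigits; case: posnP => [->|x0] //=.
by rewrite (leq_trans (trunc_logP b1 x0)) // leq_maxr.
Qed.

(** With [Q_m <= 2 P_(m+1)] the right side is at most 21 times [max(1, P_k) P_(m+1)]; since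
    [21 < P_5 = 29], a shift of the index by 4 absorbs the constant. *)
Lemma leq_index_bound n m k B :
  B <= 10 * maxn 1 (Pell k) -> Pell n = B * PellLucas m + Pell k -> n <= m + k + 4.
Proof.
move=> B_le E; have Q_le := leq_PellLucas_Pell m.
have m_gt0 := Pell_gt0 m.+1 isT.
have : Pell n <= 21 * (maxn 1 (Pell k) * Pell m.+1).
  rewrite E; apply: (@leq_trans (20 * (maxn 1 (Pell k) * Pell m.+1) + maxn 1 (Pell k))).
    by apply: leq_add; [nia | rewrite leq_maxr].
  by have := leq_maxl 1 (Pell k); nia.
case: k {B_le E} => [|k] n_le.
  suff : n < (m + 4).+1 by rewrite addn0.
  apply: ltn_Pell_imp; move: n_le (leq_PellM m 4).
  by rewrite (_ : maxn 1 (Pell 0) = 1) // [Pell 5]/=; lia.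
suff : n < (m + k + 4).+1 by lia.
apply: ltn_Pell_imp; move: n_le (leq_PellM (m + k) 4) (leq_PellM m k) (Pell_gt0 k.+1 isT).
by move=> + + + k_gt0; rewrite (maxn_idPr k_gt0) [Pell 5]/=; nia.
Qed.

(** * Factorization of differences, and residues modulo [Q_m] *)

(** The difference is [P_s Q_t] or [P_t Q_s] by the parity of [s]. As [Q_t] divides [P_(2t)], it
    divides a product of two Pell numbers, to which the valuation bound applies. *)
Lemma Pell_sub_factor n k : k < n -> odd n = odd k ->
  exists s t, [/\ n = t + s, t = k + s, 0 < s &
    exists2 D, D %| Pell s * Pell (t + t) \/ D %| Pell t * Pell (s + s) &
      Pell n = D + Pell k].
Proof.
move=> kn onk; pose s := (n - k)./2.
have ns : n = s + (s + k).
  by have := odd_double_half (n - k); rewrite oddB 1?ltnW // onk addbb -/s -addnn; lia.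
exists s, (s + k); split; [lia | lia | lia |].
rewrite ns; case os : (odd s).
  exists (Pell (s + k) * PellLucas s); last by have := PellDr s k; rewrite os; lia.
  by right; rewrite -Pell_mul_PellLucas dvdn_pmul2l ?dvdn_mull // Pell_gt0; lia.
exists (Pell s * PellLucas (s + k)); last by have := PellDl s k; rewrite os; lia.
by left; rewrite -Pell_mul_PellLucas dvdn_mul // dvdn_mull.
Qed.

Lemma Pell_near_multiple m j :
  (* This is [|m - j|], since one truncated difference is 0. *)
  exists2 i, i = (m - j) + (j - m) &
    Pell (m + j) = PellLucas m * Pell j + Pell i \/
    Pell (m + j) + Pell i = PellLucas m * Pell j.
Proof.
exists (m - j + (j - m)) => //; have [le|/ltnW le] := leqP j m.
- have := PellDl j (m - j); rewrite subnKC // (eqP le) addn0 (addnC j) (mulnC (Pell j)).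
  by case: (odd j); rewrite ?addn0; [right | left].
- have := PellDr m (j - m); rewrite subnKC // (eqP le) add0n (mulnC (Pell j)).
  by case: (odd m); rewrite ?addn0; [left | right].
Qed.

(** * Binary evaluation and explicit growth thresholds *)

Fixpoint pell_pair (n : nat) : N * N :=
  if n is n'.+1 then let (x, y) := pell_pair n' in (y, (2 * y + x)%num)
  else (0%num, 1%num).

Lemma pell_pairE n : pell_pair n = (N.of_nat (Pell n), N.of_nat (Pell n.+1)).
Proof.
elim: n => // n IH; rewrite /pell_pair -/pell_pair IH PellSS; congr pair; lia.
Qed.

Lemma N_of_Pell n : N.of_nat (Pell n) = (pell_pair n).1.
Proof. by rewrite pell_pairE. Qed.

Lemma Pell_gt_quadratic j : 15 <= j -> 625 * j ^ 2 < Pell j.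
Proof.
elim: j => [|j IH]; first by rewrite ltn0.
rewrite leq_eqVlt => /orP[/eqP<-|].
  have := N_of_Pell 15; move: (Pell 15) => x.
  by rewrite (_ : (pell_pair 15).1 = 195025%num); [lia | vm_compute].
rewrite ltnS => j15; have := IH j15; case: j j15 {IH} => // j j15.
rewrite PellSS; nia.
Qed.

(** The factor 9/4 is the square of the ratio 3/2 between [2 s t] and [(k + 3)(k + 1)] in the case
    [m < k]. *)
Lemma Pell_gt_quartic k : 25 <= k -> 9 * (625 * ((k + 3) * k.+1) ^ 2) < 4 * Pell k.
Proof.
elim: k => [|k IH]; first by rewrite ltn0.
rewrite leq_eqVlt => /orP[/eqP<-|].
  have := N_of_Pell 25; move: (Pell 25) => x.
  by rewrite (_ : (pell_pair 25).1 = 1311738121%num); [lia | vm_compute].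
rewrite ltnS => k25; have := IH k25; case: k k25 {IH} => // k k25.
rewrite PellSS => H.
have : ((k.+2 + 3) * k.+3) ^ 2 <= 2 * ((k.+1 + 3) * k.+2) ^ 2.
  have -> : (k.+2 + 3) * k.+3 = (k.+1 + 3) * k.+2 + (2 * k + 7) by lia.
  have : 5 * (2 * k + 7) <= 2 * ((k.+1 + 3) * k.+2) by nia.
  by move: ((k.+1 + 3) * k.+2) (2 * k + 7) => x y; nia.
lia.
Qed.

(** * Bounding the solutions *)

Lemma solution_bound b n m k :
  2 <= b <= 10 ->
  Pell n = b ^ ndigits b (Pell k) * PellLucas m + Pell k ->
  [/\ k <= 24, m <= 27 & n <= m + k + 4].
Proof.
move=> b_bd; have b1 : 1 < b by case/andP: b_bd.
have := ltn_exp_ndigits b (Pell k) b1; have := leq_exp_ndigits b (Pell k) b1.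
have := leq_expb_dvdn_Pell b (ndigits b (Pell k)) _ _ b_bd.
case: (ndigits b (Pell k)) (ndigits_gt0 b (Pell k)) => // d _ /=.
set B := b ^ d.+1 => dvdB leB ltB E.
have {leB} B_le : B <= 10 * maxn 1 (Pell k).
  by rewrite /B expnS leq_mul //; case/andP: b_bd.
have B_gt1 : 1 < B by rewrite -(exp1n d.+1) ltn_exp2r.
clearbody B.
have n_le : n <= m + k + 4 by apply: leq_index_bound B_le E.
have Q_gt0 := PellLucas_gt0 m.
have kn : k < n by apply: ltn_Pell_imp; rewrite E; nia.
have [lt_mk|le_km] := ltnP m k.
  suff : k <= 24 by split=> //; lia.
  have onk : odd n = odd k.
    by rewrite -(odd_Pell n) -(odd_Pell k) E oddD oddM odd_PellLucas andbF.
  have [s [t [nE tE s_gt0 [D D_dvd DE]]]] := Pell_sub_factor n k kn onk.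
  have {}DE : D = B * PellLucas m by apply/eqP; rewrite -(eqn_add2r (Pell k)) -DE E.
  (* From [n <= m + k + 4] and [m < k]: [2 s = n - k <= k + 3] and [2 t = n + k <= 3 (k + 1)]. *)
  have st_le : 2 * (2 * (s * t)) <= 3 * ((k + 3) * k.+1).
    rewrite nE tE in n_le *; move: n_le lt_mk; clear => n_le lt_mk.
    have -> : 2 * (2 * (s * (k + s))) = (2 * s) * (2 * (k + s)) by ring.
    by rewrite [leqRHS]mulnCA leq_mul //; lia.
  have B_st : B <= 625 * (2 * (s * t)) ^ 2.
    have BD : B %| D by rewrite DE dvdn_mulr.
    have t_gt0 : 0 < t by rewrite tE addn_gt0 s_gt0 orbT.
    case: D_dvd => /(dvdn_trans BD) /dvdB; rewrite ?addn_gt0 s_gt0 t_gt0 => /(_ isT isT).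
      by rewrite addnn -mul2n mulnCA.
    by rewrite addnn -mul2n mulnCA (mulnC t).
  rewrite leqNgt; apply/negP => /Pell_gt_quartic.
  move: (2 * (s * t)) ((k + 3) * k.+1) (Pell k) ltB st_le B_st; clear => x y z zB xy Bx.
  have : 4 * x ^ 2 <= 9 * y ^ 2 by have := leq_mul xy xy; clear; lia.
  lia.
(* [4 <= m] ensures [i <= m] below even when [n - m] exceeds [m], by at most 4. *)
have [m4|m4] := ltnP m 4; first by split=> //; lia.
have le_mn : m <= n.
  by apply/ltnW/ltn_Pell_imp; rewrite E; have := leq_Pell_PellLucas m; nia.
have [i iE] := Pell_near_multiple m (n - m); rewrite subnKC // E => iP.
have Qm : 2 * Pell m < PellLucas m by apply: ltn_Pell_PellLucas; lia.
have Pk : Pell k <= Pell m by apply: leq_Pell.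
have Pi : Pell i <= Pell m by apply: leq_Pell; lia.
(* [P_k] and [P_i] are both below [Q_m / 2], so the multiples of [Q_m] agree; with the minus sign
   both residues vanish. *)
have [BE ki] : B = Pell (n - m) /\ Pell k = Pell i.
  move: (Pell (n - m)) (Pell m) (Pell i) (Pell k) (PellLucas m) Qm Pk Pi iP; clear.
  by move=> u v w x y Qm Pk Pi; case: (ltngtP B u) => Bu []; split; nia.
have j15 : n - m < 15.
  rewrite ltnNge; apply/negP => j15; have := Pell_gt_quadratic _ j15.
  rewrite -BE ltnNge; case/negP.
  (* [B = P_j] divides [P_j P_1], so [B <= 625 j ^ 2]. *)
  have := dvdB (n - m) 1; rewrite BE !muln1; apply=> //; lia.
have kj : k < n - m by apply: ltn_Pell_imp; rewrite -BE.
(* With [j = n - m <= 14], this gives [m < 2 j <= 28]. *)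
suff : m - (n - m) < n - m by split; lia.
apply: ltn_Pell_imp; rewrite -BE; apply: leq_ltn_trans ltB.
by rewrite ki; apply: leq_Pell; lia.
Qed.

(** * The finite check *)

Fixpoint power_above (fuel : nat) (b a x : N) : N :=
  if fuel is fuel'.+1 then
    if (x <? a)%num then a else power_above fuel' b (a * b)%num x
  else a.

(** The search cannot stop at [e < d]: then [1 < b ^ e <= b ^ d.-1 <= max(1, x)], so
    [b ^ e <= x]. *)
Lemma power_aboveE b x d e fuel :
  1 < b -> b ^ d.-1 <= maxn 1 x -> x < b ^ d -> 0 < e <= d -> d <= e + fuel ->
  power_above fuel (N.of_nat b) (N.of_nat (b ^ e)) (N.of_nat x) = N.of_nat (b ^ d).
Proof.
move=> b1 le_x x_lt; elim: fuel e => [|f IH] e ed d_le /=.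
  by have -> : e = d by lia.
case: N.ltb_spec => [lt|le].
  have [] := ltnP e d; last by case/andP: ed => _ ed de; have -> : e = d by lia.
  move=> lt_ed; have be_gt1 : 1 < b ^ e by rewrite -(exp1n e) ltn_exp2r //; case/andP: ed.
  have : b ^ e <= b ^ d.-1 by rewrite leq_exp2l //; lia.
  by move: le_x; rewrite leq_max; lia.
have lt_ed : e < d by rewrite -(ltn_exp2l _ _ b1); lia.
rewrite -(IH e.+1); [|lia|lia]; rewrite expnSr.
by have -> : N.of_nat (b ^ e * b) = (N.of_nat (b ^ e) * N.of_nat b)%num by lia.
Qed.

Lemma N_of_PellLucas m :
  N.of_nat (PellLucas m) = (2 * ((pell_pair m).2 - (pell_pair m).1))%num.
Proof. by have := PellLucasE m; rewrite pell_pairE /fst /snd; lia. Qed.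

Definition solutions : seq (nat * nat * nat * nat) :=
  [:: (2, 3, 0, 1); (2, 3, 1, 1);
      (5, 4, 0, 2); (5, 4, 1, 2); (2, 4, 2, 0);
      (6, 4, 0, 0); (6, 4, 1, 0);
      (2, 5, 3, 1);
      (5, 6, 3, 0)].

Definition no_other_solution_upto (K M : nat) : bool :=
  let P := [seq (pell_pair n).1 | n <- iota 0 (M + K + 5)] in
  let Q := [seq (2 * ((pell_pair m).2 - (pell_pair m).1))%num | m <- iota 0 M.+1] in
  all (fun b => all (fun k =>
    let x := nth 0%num P k in
    (* Starting at [b] gives 0 one digit; fuel [2 * k] suffices since [P_k < 4 ^ k]. *)
    let B := power_above (2 * k) (N.of_nat b) (N.of_nat b) x in
    all (fun m =>
      let y := (B * nth 0%num Q m + x)%num in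
      (* The [if] delays the membership test until an equality is found. *)
      all (fun n => if (nth 0%num P n =? y)%num then (b, n, m, k) \in solutions else true)
        (iota 0 (m + k + 5)))
      (iota 0 M.+1))
    (iota 0 K.+1))
    (iota 2 9).

Lemma no_other_solution_uptoP K M b n m k :
  no_other_solution_upto K M ->
  2 <= b <= 10 -> k <= K -> m <= M -> n <= m + k + 4 ->
  Pell n = b ^ ndigits b (Pell k) * PellLucas m + Pell k ->
  (b, n, m, k) \in solutions.
Proof.
move=> chk b_bd kK mM n_le E.
have b1 : 1 < b by case/andP: b_bd.
have {chk} /allP/(_ b) := chk; rewrite mem_iota => /(_ b_bd).
move=> /allP/(_ k); rewrite mem_iota ltnS => /(_ kK).
move=> /allP/(_ m); rewrite mem_iota ltnS => /(_ mM).
move=> /allP/(_ n); rewrite mem_iota => /(_ _).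
rewrite !(nth_map 0) ?size_iota ?nth_iota; try lia.
rewrite !add0n -N_of_PellLucas -!N_of_Pell.
have d_le : ndigits b (Pell k) <= 1 + 2 * k.
  rewrite add1n -ltnS -(prednK (ndigits_gt0 b (Pell k))) !ltnS -(leq_exp2l _ _ (ltnSn 1)).
  have le1 : 2 ^ (ndigits b (Pell k)).-1 <= b ^ (ndigits b (Pell k)).-1.
    by case: (_.-1) => // e; rewrite leq_exp2r.
  apply: leq_trans le1 (leq_trans (leq_exp_ndigits _ _ b1) _).
  by rewrite expnM geq_max expn_gt0 /= ltnW ?Pell_lt_exp4.
have := power_aboveE b (Pell k) _ 1 (2 * k) b1 (leq_exp_ndigits _ _ b1)
  (ltn_exp_ndigits _ _ b1) (ndigits_gt0 _ _) d_le.
rewrite expn1 => ->.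
rewrite (_ : (_ =? _)%num = true); first by apply; lia.
by apply/N.eqb_spec; lia.
Qed.

Lemma no_other_solution : no_other_solution_upto 24 27.
Proof. by vm_compute. Qed.

Theorem theorem4 (b n m k : nat) :
  2 <= b <= 10 ->
  (Pell n = b ^ ndigits b (Pell k) * PellLucas m + Pell k <->
   (b, n, m, k) \in [:: (2, 3, 0, 1); (2, 3, 1, 1);
                        (5, 4, 0, 2); (5, 4, 1, 2); (2, 4, 2, 0);
                        (6, 4, 0, 0); (6, 4, 1, 0);
                        (2, 5, 3, 1);
                        (5, 6, 3, 0)]).
Proof.
move=> b_bd; split=> [E|].
  have [kK mM n_le] := solution_bound _ _ _ _ b_bd E.
  exact: no_other_solution_uptoP no_other_solution b_bd kK mM n_le E.
by do ![rewrite in_cons => /orP[/eqP[-> -> -> ->] //|]].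
Qed.
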